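(* Let $\mathcal{X}$ be an infinite-dimensional Hilbert space and let $T\in\mathcal{B}[\mathcal{X}]$ be a contraction that is weakly l-sequentially supercyclic. Let $U$, acting on the subspace $\mathcal{U}\subseteq\mathcal{X}$, be the unitary part of $T$. Then either (i) $T$ is weakly stable, or (ii) if $y\in\mathcal{U}$ is a weakly l-sequentially supercyclic vector for $U$ such that $\{U^ny\}_{n\ge0}$ does not converge weakly to $0$, then for every nonzero $z\in\mathcal{U}$ such that $\langle U^ny\,;z\rangle\not\to0$ either $$\liminf_n|\langle U^ny\,;z\rangle|=0,$$ or $$\limsup_k|\langle U^{n_k}y\,;z\rangle|<\|z\|\,\|y\|$$ for some subsequence $\{U^{n_k}\}_{k\ge0}$ of $\{U^n\}_{n\ge0}$.
   Context: The scalar field is $\mathbb{F}$, either $\mathbb{R}$ or $\mathbb{C}$. $\langle\,\cdot\,;\cdot\,\rangle$ denotes the inner product. $\mathcal{B}[\mathcal{X}]$ is the algebra of all operators (bounded linear maps) of $\mathcal{X}$ into itself. $T$ is a contraction if $\|T\|\le1$. $T$ is weakly stable if $T^nx$ converges weakly to $0$ for every $x\in\mathcal{X}$. Unitary part: by the Nagy–Foiaş–Langer decomposition, for a contraction $T$ the space $\mathcal{X}$ admits an orthogonal decomposition $\mathcal{X}=\mathcal{U}^\perp\oplus\mathcal{U}$ reducing $T$ for which $T$ is uniquely a direct sum $T=C\oplus U$, where $C=T|_{\mathcal{U}^\perp}$ is a completely nonunitary contraction (no restriction of $C$ to a nonzero reducing subspace is unitary) and $U=T|_{\mathcal{U}}$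 is unitary; either summand may be missing (i.e., act on the zero space). $U$ is called the unitary part of $T$. For an operator $S$ on a normed space $\mathcal{Y}$, a nonzero vector $y\in\mathcal{Y}$ is a weakly l-sequentially supercyclic vector for $S$ if for every $x\in\mathcal{Y}$ there exist a sequence $\{\alpha_k\}_{k\ge0}$ of nonzero numbers in $\mathbb{F}$ and a subsequence $\{S^{n_k}\}_{k\ge0}$ of $\{S^n\}_{n\ge0}$ (both depending on $x$ and $y$) such that $\alpha_kS^{n_k}y$ converges weakly to $x$. $S$ is weakly l-sequentially supercyclic if it has a weakly l-sequentially supercyclic vector. *)

(* Defs.v *)
From HB Require Import structures.
From mathcomp Require Import all_boot all_order all_algebra.
From mathcomp Require Import sesquilinear complex.
From mathcomp Require Import all_classical all_reals all_analysis.

Set Implicit Arguments.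
Unset Strict Implicit.
Unset Printing Implicit Defensive.

Import Order.TTheory GRing.Theory Num.Theory.
Import numFieldNormedType.Exports.

Local Open Scope classical_set_scope.
Local Open Scope ring_scope.

Inductive scalar_kind := RealScalars | ComplexScalars.

Definition base_field (R : realType) (F : scalar_kind) : numFieldType :=
  match F with RealScalars => R | ComplexScalars => R[i] end.

Definition sconj {R : realType} {F : scalar_kind} :
    base_field R F -> base_field R F :=
  match F with
  | RealScalars => fun x : R => x
  | ComplexScalars => fun x : R[i] => Num.conj x
  end.

(* In a [normedModType K] the norm takes its values in [K]; [sre] brings the
   norms and absolute values of the complex case back to [R]. *)
Definition sre {R : realType} {F : scalar_kind} : base_field R F -> R :=
  match F with
  | RealScalars => fun x : R => x
  | ComplexScalars => fun x : R[i] => complex.Re x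
  end.

Definition rnorm {R : realType} {F : scalar_kind}
    {V : normedZmodType (base_field R F)} (x : V) : R := sre `|x|.

Definition rabs {R : realType} {F : scalar_kind} (a : base_field R F) : R :=
  sre `|a|.

(* The inner product is linear in its first argument. *)
HB.mixin Record NormedModule_isPreHilbert (R : realType) (F : scalar_kind) X
    & NormedModule (base_field R F) X := {
  inner : {dot X for @sconj R F};
  sqr_norm_inner : forall x : X, `|x| ^+ 2 = inner x x
}.

#[short(type="hilbertType")]
HB.structure Definition Hilbert (R : realType) (F : scalar_kind) :=
  {X of CompleteNormedModule (base_field R F) X & NormedModule_isPreHilbert R F X}.

Section ClosedSubspace.
Variables (K : numFieldType) (X : normedModType K).

Record csubspace := CSubspace {
  csubspace_set : set X;
  csubspaceP : submod_closed (fun x => `[< csubspace_set x >]);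
  csubspace_closed : closed csubspace_set
}.

Definition csubspace_pred (M : csubspace) (x : X) : bool :=
  `[< csubspace_set M x >].

HB.instance Definition _ (M : csubspace) :=
  GRing.isSubmodClosed.Build K X (csubspace_pred M) (csubspaceP M).

End ClosedSubspace.

Section ClosedSubspaceType.
Variables (K : numFieldType) (X : normedModType K) (M : csubspace X).

Record csubspace_type := CSubspaceElt {
  csubspace_val :> X;
  _ : csubspace_pred M csubspace_val
}.

HB.instance Definition _ := [isSub for csubspace_val].
HB.instance Definition _ := [Choice of csubspace_type by <:].
HB.instance Definition _ := [SubChoice_isSubLmodule of csubspace_type by <:].

Let csubspace_val_linear : linear csubspace_val.
Proof. by move=> a x y; rewrite -[csubspace_val _]/(\val _) linearP. Qed.
HB.instance Definition _ :=
  GRing.isLinear.Build K csubspace_type X *:%R csubspace_val csubspace_val_linear.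

Let nrm (x : csubspace_type) : K := `|\val x|.

Let nrmD x y : nrm (x + y) <= nrm x + nrm y.
Proof. by rewrite /nrm raddfD /= ler_normD. Qed.

Let nrmZ (l : K) x : nrm (l *: x) = `|l| * nrm x.
Proof. by rewrite /nrm linearZ /= normrZ. Qed.

Let nrm0_eq0 x : nrm x = 0 -> x = 0.
Proof. by move=> /normr0_eq0 x0; apply: val_inj; rewrite raddf0. Qed.

HB.instance Definition _ :=
  Lmodule_isNormed.Build K csubspace_type nrmD nrmZ nrm0_eq0.

Lemma csubspace_normE (x : csubspace_type) : `|x| = `|csubspace_val x|.
Proof. by []. Qed.

Lemma csubspace_valP (x : csubspace_type) : csubspace_set M x.
Proof. by case: x => x /= /asboolP. Qed.

End ClosedSubspaceType.
Coercion csubspace_type : csubspace >-> Sortclass.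

Section ClosedSubspaceComplete.
Variables (K : numFieldType) (X : completeNormedModType K) (M : csubspace X).

Let sub_complete (G : set_system M) : ProperFilter G -> cauchy G -> cvg G.
Proof.
move=> PG /cauchyP cG.
have cvX : cvg ((@csubspace_val K X M) @ G).
  apply: cauchy_cvg; apply/cauchy_exP => e e0.
  have [x Gx] := cG e e0; exists (csubspace_val x).
  suff : ball x e `<=` csubspace_val (M := M) @^-1` ball (csubspace_val x) e.
    by move=> xe; exact: (filterS xe Gx).
  by move=> y /=; rewrite -!ball_normE.
have /cvg_ex[x Gx] := cvX.
have Mx : csubspace_set M x.
  have MG : \forall y \near G, csubspace_set M (csubspace_val y).
    by apply: nearW => y; exact: csubspace_valP.
  exact: (@closed_cvg M X G PG (@csubspace_val K X M) (csubspace_set M)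
            (@csubspace_closed K X M) MG x Gx).
have Px : csubspace_pred M x by apply/asboolP.
apply/cvg_ex; exists (CSubspaceElt Px).
apply/cvgrPdist_lt => e e0.
by move/cvgrPdist_lt : Gx => /(_ e e0).
Qed.

HB.instance Definition _ := Uniform_isComplete.Build M sub_complete.

End ClosedSubspaceComplete.

Section ClosedSubspaceHilbert.
Variables (R : realType) (F : scalar_kind) (X : hilbertType R F).
Variable M : csubspace X.

Let sinner (x y : M) : base_field R F := inner (csubspace_val x) (csubspace_val y).

Let sinnerl y : zmod_morphism (sinner ^~ y).
Proof. by move=> x x'; rewrite /sinner raddfB /= zmod_morphisml_subproof. Qed.
Let sinnerr x : zmod_morphism (sinner x).
Proof. by move=> y y'; rewrite /sinner raddfB. Qed.
Let sinnerZl y : scalable_for *%R (sinner ^~ y).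
Proof. by move=> a x; rewrite /sinner linearZ /= linearl_subproof. Qed.
Let sinnerZr x : scalable_for (@sconj R F \; *%R) (sinner x).
Proof. by move=> a y; rewrite /sinner [csubspace_val (_ *: _)]linearZ linearr_subproof. Qed.

HB.instance Definition _ := @isBilinear.Build
  (base_field R F) M M (base_field R F) *%R (@sconj R F \; *%R) sinner
  sinnerl sinnerr sinnerZl sinnerZr.

Let sinner_herm (x y : M) : sinner x y = (-1) ^+ false * sconj (sinner y x).
Proof. exact: hermitian_subproof. Qed.
HB.instance Definition _ := @isHermitianSesquilinear.Build
  (base_field R F) M false (@sconj R F) sinner sinner_herm.

Let sinner_gt0 (x : M) : x != 0 -> 0 < sinner x x.
Proof. 
by move=> x0; apply: neq0_dnorm_gt0; apply: contra_neq x0 => x0; apply/val_inj. 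
Qed.
HB.instance Definition _ := @isDotProduct.Build (base_field R F) M sinner sinner_gt0.

Let sinner_norm (x : M) : `|x| ^+ 2 = sinner x x.
Proof. by rewrite /sinner -sqr_norm_inner. Qed.
HB.instance Definition _ := NormedModule_isPreHilbert.Build R F M sinner_norm.

End ClosedSubspaceHilbert.

Lemma csubspace_innerE (R : realType) (F : scalar_kind) (X : hilbertType R F)
  (M : csubspace X) (x y : M) :
  inner x y = inner (csubspace_val x) (csubspace_val y).
Proof. by []. Qed.


Section InnerTheory.
Variables (R : realType) (F : scalar_kind) (X : hilbertType R F).
Implicit Types x y z : X.

Lemma sconj0 : sconj (0 : base_field R F) = 0.
Proof. by case: F => //=; rewrite rmorph0. Qed.

Lemma innerC x y : inner x y = sconj (inner y x).
Proof. by rewrite hermitian_subproof expr0 mul1r. Qed.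

Lemma innerBl x y z : inner (x - y) z = inner x z - inner y z.
Proof. exact: zmod_morphisml_subproof. Qed.

Lemma innerBr x y z : inner x (y - z) = inner x y - inner x z.
Proof. exact: zmod_morphismr_subproof. Qed.

Lemma inner0l y : inner 0 y = 0.
Proof. by rewrite -(subrr y) innerBl subrr. Qed.

Lemma inner0r y : inner y 0 = 0.
Proof. by rewrite -(subrr y) innerBr subrr. Qed.

Lemma innerDl x y z : inner (x + y) z = inner x z + inner y z.
Proof. by rewrite -{1}(opprK y) innerBl -(sub0r y) innerBl inner0l sub0r opprK. Qed.

Lemma innerDr x y z : inner x (y + z) = inner x y + inner x z.
Proof. by rewrite -{1}(opprK z) innerBr -(sub0r z) innerBr inner0r sub0r opprK. Qed.

Lemma innerZl a x y : inner (a *: x) y = a * inner x y.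
Proof. exact: linearl_subproof. Qed.

Lemma innerZr a x y : inner x (a *: y) = sconj a * inner x y.
Proof. exact: linearr_subproof. Qed.

Lemma pythagoras x y : inner x y = 0 -> `|x + y| ^+ 2 = `|x| ^+ 2 + `|y| ^+ 2.
Proof.
move=> xy; rewrite !sqr_norm_inner innerDl !innerDr xy.
by rewrite (innerC y) xy sconj0 addr0 add0r.
Qed.

Lemma cauchy_schwarz x y : `|inner x y| <= `|x| * `|y|.
Proof.
have [->|y0] := eqVneq y 0; first by rewrite inner0r !normr0 mulr0.
have ny0 : 0 < `|y| by rewrite normr_gt0.
pose k := inner x y / `|y| ^+ 2.
have ky : inner (x - k *: y) y = 0.
  by rewrite innerBl innerZl -sqr_norm_inner divfK ?subrr// expf_neq0// gt_eqF.
have kyk : inner (x - k *: y) (k *: y) = 0 by rewrite innerZr ky mulr0.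
have := pythagoras kyk; rewrite subrK => xE.
have kx : `|k *: y| <= `|x|.
  by rewrite -(@ler_pXn2r _ 2)// ?nnegrE// xE lerDr exprn_ge0.
move: kx; rewrite normrZ /k normrM normfV normrX normr_id expr2 invfM mulrA.
by rewrite mulfVK ?gt_eqF// ler_pdivrMr.
Qed.

End InnerTheory.

Section OrthogonalComplement.
Variables (R : realType) (F : scalar_kind) (X : hilbertType R F).
Variable M : csubspace X.

Definition orthc_set : set X :=
  [set x | forall y, csubspace_set M y -> inner x y = 0].

Let orthc_submod : submod_closed (fun x => `[< orthc_set x >]).
Proof.
split=> [|a x y /asboolP Mx /asboolP My]; apply/asboolP => z Mz.
  by rewrite inner0l.
by rewrite innerDl innerZl Mx// My// mulr0 addr0.
Qed.

Let orthc_closed : closed orthc_set.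
Proof.
move=> x clx y My; apply/eqP; rewrite -normr_le0.
apply/ler_addgt0Pr => e e0; rewrite add0r.
have y0 : 0 < `|y| + 1 by rewrite ltr_wpDl.
have [z [Mz]] := clx _ (nbhsx_ballx x (e / (`|y| + 1)) (divr_gt0 e0 y0)).
rewrite -ball_normE /= => xz.
rewrite -[inner x y]subr0 -(Mz y My) -innerBl.
rewrite (le_trans (cauchy_schwarz _ _))//.
rewrite (le_trans (ler_wpM2r _ (ltW xz)))//.
by rewrite -mulrA ler_piMr ?(ltW e0)// ler_pdivrMl// mulr1 lerDl.
Qed.

Definition orthc : csubspace X := CSubspace orthc_submod orthc_closed.

End OrthogonalComplement.

Section Weak.
Variables (K : numFieldType) (Y : normedModType K).

(* The continuous linear functionals of [Y] are its dual, also when [Y] is the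
   type of a closed subspace. *)
Definition weak_cvg (u : nat -> Y) (l : Y) : Prop :=
  forall f : {linear Y -> K^o}, continuous f -> f (u n) @[n --> \oo] --> f l.

Definition weakly_stable (S : {linear Y -> Y}) : Prop :=
  forall x : Y, weak_cvg (fun n => iter n S x) 0.

Definition wl_seq_supercyclic_vector (S : {linear Y -> Y}) (y : Y) : Prop :=
  y != 0 /\
  forall x : Y, exists (alpha : nat -> K) (n_ : nat -> nat),
    [/\ forall k, alpha k != 0,
        {homo n_ : i j / (i < j)%N} &
        weak_cvg (fun k => alpha k *: iter (n_ k) S y) x].

Definition wl_seq_supercyclic (S : {linear Y -> Y}) : Prop :=
  exists y, wl_seq_supercyclic_vector S y.

Definition infinite_dimensional : Prop :=
  forall (n : nat) (e : 'I_n -> Y),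
    ~ (forall x : Y, exists c : 'I_n -> K, x = \sum_(i < n) c i *: e i).

End Weak.
Arguments infinite_dimensional {K} Y.

Section Operators.
Variables (R : realType) (F : scalar_kind).
Implicit Types H : hilbertType R F.

(* [sup] of an unbounded set is 0: only meaningful for a continuous [T]. *)
Definition opnorm H (T : {linear H -> H}) : R :=
  sup [set rnorm (T x) | x in [set x : H | rnorm x <= 1]].

Definition is_adjoint H (T A : {linear H -> H}) : Prop :=
  forall x y : H, inner (T x) y = inner x (A y).

Definition unitary H (T : {linear H -> H}) : Prop :=
  exists A : {linear H -> H}, [/\ is_adjoint T A, cancel T A & cancel A T].

Definition invariant H (M : csubspace H) (T : {linear H -> H}) : Prop :=
  forall x, csubspace_set M x -> csubspace_set M (T x).

Definition reduces H (M : csubspace H) (T : {linear H -> H}) : Prop :=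
  invariant M T /\ invariant (orthc M) T.

Definition is_restriction H (T : {linear H -> H}) (M : csubspace H)
    (V : {linear M -> M}) : Prop :=
  forall x : M, csubspace_val (V x) = T (csubspace_val x).

Definition completely_nonunitary H (C : {linear H -> H}) : Prop :=
  forall (N : csubspace H) (V : {linear N -> N}),
    reduces N C -> is_restriction C V -> (exists x : N, x != 0) -> ~ unitary V.

Definition is_unitary_part H (T : {linear H -> H}) (M : csubspace H)
    (U : {linear M -> M}) : Prop :=
  [/\ reduces M T, is_restriction T U, unitary U &
      exists C : {linear orthc M -> orthc M},
        is_restriction T C /\ completely_nonunitary C].

End Operators.

(* Main.v *)
Require Import Defs.
From HB Require Import structures.
From mathcomp Require Import all_boot all_order all_algebra.
From mathcomp Require Import sesquilinear complex.
From mathcomp Require Import all_classical all_reals all_analysis.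
From mathcomp Require Import ring.

Import Order.TTheory GRing.Theory Num.Theory.
Import numFieldNormedType.Exports.

Local Open Scope classical_set_scope.
Local Open Scope ring_scope.

(** Suppose that no subsequence of |<U^n y; z>| has its upper limit below
    |z| |y|. As |z| |y| is also an upper bound, |<U^n y; z>| then converges to
    it: the vectors U^n y, all of norm |y|, align asymptotically with the line
    through z ([cvg_of_no_subsequence_limn_sup_lt]).

    Since U preserves inner products, |<U^(n+1) y; U z>| = |<U^n y; z>|, so the
    same vectors also align with the line through U z. A sequence cannot align
    with two different lines ([parallel_of_asymptotic_alignment]), hence
    U z = mu z, and |mu| = 1 because U is isometric.

    So z is an eigenvector of the contraction T for a unimodular eigenvalue,
    and then it is an eigenvector of the adjoint of T as well:
    <T x; z> = mu <x; z> for all x ([contraction_adjoint_eigenvector]). If x is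
    a supercyclic vector of T and alpha_k T^(n_k) x converges weakly to
    z + s v with v orthogonal to z, then testing against z fixes the limit
    |z|^2 / |<x; z>| of |alpha_k|, independently of s; testing against v shows
    that |s| |v|^2 is at most this limit times |x| |v|. Letting s grow gives
    v = 0 ([supercyclic_orth_eigenvector]). So z spans the whole space, which
    contradicts infinite dimension. *)

(** * Real-valued norms and moduli over both scalar fields *)

Section RealNorms.
Context {R : realType} {F : scalar_kind}.
Local Notation K := (base_field R F).

(** Norms take their values in [K], which is only partially ordered in the
    complex case; inequalities are carried between [K] and [R] along this
    embedding. *)
Definition real_scalar : R -> K :=
  match F with RealScalars => fun x => x | ComplexScalars => fun x => (x%:C)%C end.

Lemma le_real_scalar : {mono real_scalar : x y / x <= y}.
Proof. by rewrite /real_scalar; case: F => // x y; rewrite lecR. Qed.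

Lemma real_scalar_inj : injective real_scalar.
Proof. by move=> x y xy; apply/le_anti; rewrite -!le_real_scalar xy lexx. Qed.

Lemma real_scalarB x y : real_scalar (x - y) = real_scalar x - real_scalar y.
Proof. by rewrite /real_scalar; case: F => //; rewrite rmorphB. Qed.

Lemma real_scalarM x y : real_scalar (x * y) = real_scalar x * real_scalar y.
Proof. by rewrite /real_scalar; case: F => //; rewrite rmorphM. Qed.

Lemma real_scalar0 : real_scalar 0 = 0.
Proof. by rewrite -(subrr 0) real_scalarB subrr. Qed.

Lemma real_scalar1 : real_scalar 1 = 1.
Proof. by rewrite /real_scalar; case: F => //; rewrite rmorph1. Qed.

Lemma real_scalarX x n : real_scalar (x ^+ n) = real_scalar x ^+ n.
Proof.
by elim: n => [|n IH]; rewrite ?expr0 ?real_scalar1// !exprS real_scalarM IH.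
Qed.

Lemma real_scalar_sre (a : K) : 0 <= a -> real_scalar (sre a) = a.
Proof.
rewrite /real_scalar /sre; case: F a => // a a0.
exact/RRe_real/ger0_real.
Qed.

Lemma real_scalar_rabs (a : K) : real_scalar (rabs a) = `|a|.
Proof. exact: real_scalar_sre. Qed.

Lemma real_scalar_rnorm {V : normedZmodType K} (x : V) :
  real_scalar (rnorm x) = `|x|.
Proof. exact: real_scalar_sre. Qed.

Lemma rabs_ge0 (a : K) : 0 <= rabs a.
Proof. by rewrite -le_real_scalar real_scalar0 real_scalar_rabs. Qed.

Lemma rnorm_ge0 {V : normedZmodType K} (x : V) : 0 <= rnorm x.
Proof. by rewrite -le_real_scalar real_scalar0 real_scalar_rnorm. Qed.

Lemma rnorm_gt0 {V : normedZmodType K} (x : V) : x != 0 -> 0 < rnorm x.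
Proof.
move=> x0; rewrite lt_neqAle rnorm_ge0 andbT; apply: contra_neq x0 => x0.
by apply: normr0_eq0; rewrite -real_scalar_rnorm -x0 real_scalar0.
Qed.

Lemma rabsM (a b : K) : rabs (a * b) = rabs a * rabs b.
Proof.
by apply: real_scalar_inj; rewrite real_scalarM !real_scalar_rabs normrM.
Qed.

Lemma ler_dist_rabs (a b : K) : `|rabs a - rabs b| <= rabs (a - b).
Proof.
have sub (c d : K) : rabs c - rabs d <= rabs (c - d).
  by rewrite -le_real_scalar real_scalarB !real_scalar_rabs lerB_dist.
rewrite ler_norml sub andbT lerNl opprB.
suff -> : rabs (a - b) = rabs (b - a) by exact: sub.
by apply: real_scalar_inj; rewrite !real_scalar_rabs distrC.
Qed.

Lemma cvg_rabs (u : nat -> K) (l : K) :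
  u n @[n --> \oo] --> (l : K^o) -> rabs (u n) @[n --> \oo] --> rabs l.
Proof.
move=> /cvgrPdist_le ul; apply/cvgrPdist_le => e e0.
have e0' : 0 < real_scalar e.
  by rewrite lt_neqAle -real_scalar0 le_real_scalar (ltW e0) andbT
    (inj_eq real_scalar_inj) eq_sym gt_eqF.
apply: filterS (ul _ e0') => n; rewrite -real_scalar_rabs le_real_scalar.
exact/le_trans/ler_dist_rabs.
Qed.

Lemma sconj_mulC (a : K) : a * sconj a = `|a| ^+ 2.
Proof.
rewrite /sconj; case: F a => /= a; last by rewrite normCK.
by rewrite real_normK ?num_real// expr2.
Qed.

Lemma norm_sconj (a : K) : `|sconj a| = `|a|.
Proof. by rewrite /sconj; case: F a => //= a; rewrite norm_conjC. Qed.

End RealNorms.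

(** * Asymptotic alignment with a line *)

Lemma cvg_sqr (R : realType) (u : nat -> R) (l : R) :
  u n @[n --> \oo] --> l -> u n ^+ 2 @[n --> \oo] --> l ^+ 2.
Proof. by move=> ul; rewrite expr2; apply: cvgM. Qed.

Section EqualityCaseOfCauchySchwarz.
Context {R : realType} {F : scalar_kind} {H : hilbertType R F}.
Implicit Types u w z : H.
Local Notation K := (base_field R F).

(** The component of [u] orthogonal to [z], multiplied by [`|z| ^+ 2] to avoid
    a division. *)
Definition scaled_rejection u z : H := `|z| ^+ 2 *: u - inner u z *: z.

Lemma inner_scaled_rejection u w z :
  inner (scaled_rejection u z) w = `|z| ^+ 2 * inner u w - inner u z * inner z w.
Proof. by rewrite innerBl !innerZl. Qed.

Lemma sqr_norm_scaled_rejection u z : `|scaled_rejection u z| ^+ 2 =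
  `|z| ^+ 2 * (`|z| ^+ 2 * `|u| ^+ 2 - `|inner u z| ^+ 2).
Proof.
have orth : inner (scaled_rejection u z) (inner u z *: z) = 0.
  by rewrite innerZr inner_scaled_rejection -sqr_norm_inner mulrC
    [X in X - _]mulrC subrr mul0r.
have zu : `| (`|z| ^+ 2) *: u | = `|z| ^+ 2 * `|u|.
  by rewrite normrZ ger0_norm ?exprn_ge0.
have := pythagoras orth; rewrite subrK zu normrZ => e.
apply: (addIr ((`|inner u z| * `|z|) ^+ 2)); rewrite -e; ring.
Qed.

Lemma inner_rabs_le u w : rabs (inner u w) <= rnorm u * rnorm w.
Proof.
rewrite -(@le_real_scalar R F) real_scalarM real_scalar_rabs !real_scalar_rnorm.
exact: cauchy_schwarz.
Qed.

Lemma rabs_innerC u w : rabs (inner u w) = rabs (inner w u).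
Proof.
by apply: (@real_scalar_inj R F); rewrite !real_scalar_rabs innerC norm_sconj.
Qed.

Lemma rabs_inner_diag u : rabs (inner u u) = rnorm u ^+ 2.
Proof.
apply: (@real_scalar_inj R F); rewrite real_scalar_rabs -sqr_norm_inner.
by rewrite real_scalarX real_scalar_rnorm ger0_norm ?exprn_ge0.
Qed.

Lemma cauchy_schwarz_eq w z : rnorm z * rnorm w <= rabs (inner w z) ->
  `|z| ^+ 2 *: w = inner w z *: z.
Proof.
rewrite -(@le_real_scalar R F) real_scalarM real_scalar_rabs !real_scalar_rnorm => wz.
apply/eqP; rewrite -subr_eq0 -normr_eq0 -sqrf_eq0 sqr_norm_scaled_rejection.
rewrite -exprMn (_ : `|inner w z| = `|z| * `|w|) ?subrr ?mulr0//.
by apply/le_anti; rewrite wz mulrC cauchy_schwarz.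
Qed.

(** The left-hand side compares [inner u w] with its value after replacing [u]
    by its projection on the line through [z]. The difference is the product of
    the rejection of [u] with [w], and Cauchy-Schwarz bounds it by the defect of
    equality for the pair [u], [z]. *)
Lemma inner_mul_approx u w z :
  (rnorm z ^+ 2 * rabs (inner u w) - rabs (inner u z) * rabs (inner z w)) ^+ 2
  <= rnorm w ^+ 2 * (rnorm z ^+ 2 *
       (rnorm z ^+ 2 * rnorm u ^+ 2 - rabs (inner u z) ^+ 2)).
Proof.
have rej : rnorm (scaled_rejection u z) ^+ 2 =
    rnorm z ^+ 2 * (rnorm z ^+ 2 * rnorm u ^+ 2 - rabs (inner u z) ^+ 2).
  apply: (@real_scalar_inj R F); rewrite !(real_scalarX,real_scalarM,real_scalarB).
  by rewrite real_scalar_rabs !real_scalar_rnorm sqr_norm_scaled_rejection.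
have zz : rabs (`|z| ^+ 2 : K) = rnorm z ^+ 2.
  by rewrite sqr_norm_inner rabs_inner_diag.
rewrite -rej -exprMn -zz -!rabsM.
rewrite -[X in X <= _]real_normK ?num_real//.
rewrite ler_sqr ?nnegrE ?mulr_ge0 ?rnorm_ge0//.
apply: le_trans (ler_dist_rabs _ _) _.
by rewrite -inner_scaled_rejection mulrC inner_rabs_le.
Qed.

(** In the limit the projection of [u n] on the line through [z] carries the
    whole norm of [u n], so the limit [rnorm w * b] of its product with [w] is
    the maximal one; this forces equality in Cauchy-Schwarz for [w], [z]. *)
Lemma parallel_of_asymptotic_alignment (u : nat -> H) (b : R) w z :
  0 < b -> z != 0 -> (forall n, rnorm (u n) = b) ->
  rabs (inner (u n) z) @[n --> \oo] --> rnorm z * b ->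
  rabs (inner (u n) w) @[n --> \oo] --> rnorm w * b ->
  `|z| ^+ 2 *: w = inner w z *: z.
Proof.
move=> b0 z0 ub uz uw; apply: cauchy_schwarz_eq.
have z1 := rnorm_gt0 _ z0.
set c := rabs (inner z w).
have : (rnorm z ^+ 2 * (rnorm w * b) - (rnorm z * b) * c) ^+ 2 <=
  rnorm w ^+ 2 * (rnorm z ^+ 2 * (rnorm z ^+ 2 * b ^+ 2 - (rnorm z * b) ^+ 2)).
  apply: (@ler_cvg_to _ \oo _ _
    (fun n => (rnorm z ^+ 2 * rabs (inner (u n) w)
               - rabs (inner (u n) z) * c) ^+ 2)
    (fun n => rnorm w ^+ 2 * (rnorm z ^+ 2 *
       (rnorm z ^+ 2 * b ^+ 2 - rabs (inner (u n) z) ^+ 2)))).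
  - apply: (cvg_sqr _ (fun n => rnorm z ^+ 2 * rabs (inner (u n) w)
                                - rabs (inner (u n) z) * c)).
    apply: cvgB; first by apply: cvgM => //; exact: cvg_cst.
    by apply: cvgM => //; exact: cvg_cst.
  - apply: cvgM; first exact: cvg_cst.
    apply: cvgM; first exact: cvg_cst.
    by apply: cvgB; [exact: cvg_cst|exact: cvg_sqr].
  - apply: nearW => n; rewrite -(ub n); exact: inner_mul_approx.
rewrite exprMn subrr !mulr0 => le0.
have /eqP : (rnorm z ^+ 2 * (rnorm w * b) - (rnorm z * b) * c) ^+ 2 = 0.
  by apply/le_anti; rewrite le0 sqr_ge0.
rewrite sqrf_eq0 rabs_innerC -/c => /eqP e.
have : rnorm z * b * (rnorm z * rnorm w - c) = 0 by rewrite -[RHS]e; ring.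
by move/eqP; rewrite !mulf_eq0 (gt_eqF z1) (gt_eqF b0)/= subr_eq0 => /eqP->.
Qed.

End EqualityCaseOfCauchySchwarz.

(** * Weak limits tested against vectors *)

Section WeakLimits.
Context {R : realType} {F : scalar_kind} {H : hilbertType R F}.
Local Notation K := (base_field R F).

Definition inner_with (w : H) (x : H) : K^o := inner x w.

Lemma inner_with_is_linear w : linear (inner_with w).
Proof. by move=> a x y; rewrite /inner_with innerDl innerZl. Qed.

HB.instance Definition _ (w : H) :=
  GRing.isLinear.Build K H K^o *:%R (inner_with w) (inner_with_is_linear w).

Lemma continuous_inner_with w : continuous (inner_with w).
Proof.
apply: bounded_linear_continuous; apply/linear_boundedP.
near=> r => x; apply: le_trans (cauchy_schwarz x w) _.
rewrite mulrC ler_wpM2r//; near: r; apply: nbhs_pinfty_ge.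
Unshelve. all: by end_near. Qed.

Lemma weak_cvg_inner (u : nat -> H) (l w : H) :
  weak_cvg u l -> inner (u n) w @[n --> \oo] --> (inner l w : K^o).
Proof. by move=> ul; apply: (ul (inner_with w)); exact: continuous_inner_with. Qed.

End WeakLimits.

(** * Unimodular eigenvectors of contractions *)

Section Contractions.
Context {R : realType} {F : scalar_kind} {H : hilbertType R F}.
Local Notation K := (base_field R F).
Variable T : {linear H -> H}.

Lemma opnorm_ge (x : H) :
  continuous T -> rnorm x <= 1 -> rnorm (T x) <= opnorm T.
Proof.
move=> Tc x1; apply: ub_le_sup; last by exists x.
have /pinfty_ex_gt0[r r0 Tr] :
    \forall r \near +oo, forall x, `|T x| <= r * `|x|.
  by apply/linear_boundedP; apply: continuous_linear_bounded; exact: Tc.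
exists (sre r) => _ [y y1 <-].
rewrite -(@le_real_scalar R F) real_scalar_rnorm (real_scalar_sre _ (ltW r0)).
apply: le_trans (Tr y) _; rewrite ler_piMr ?(ltW r0)//.
by rewrite -real_scalar_rnorm -real_scalar1 le_real_scalar.
Qed.

Lemma contraction_norm_le : continuous T -> opnorm T <= 1 ->
  forall x, `|T x| <= `|x|.
Proof.
move=> Tc T1 x; have [->|x0] := eqVneq x 0; first by rewrite linear0.
have nx0 : 0 < `|x| by rewrite normr_gt0.
have x1 : `| (`|x|^-1) *: x | = 1.
  by rewrite normrZ gtr0_norm ?invr_gt0// mulVf ?gt_eqF.
have : rnorm (T (`|x|^-1 *: x)) <= 1.
  apply: le_trans T1; apply: opnorm_ge => //.
  by rewrite -(@le_real_scalar R F) real_scalar_rnorm x1 real_scalar1.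
rewrite -(@le_real_scalar R F) real_scalar_rnorm real_scalar1 linearZ normrZ.
by rewrite gtr0_norm ?invr_gt0// ler_pdivrMl// mulr1.
Qed.

Hypothesis T_le : forall x, `|T x| <= `|x|.
Variables (z : H) (mu : K).
Hypotheses (z0 : z != 0) (Tz : T z = mu *: z) (mu1 : `|mu| = 1).

(** Perturb [z] by a small multiple [s *: v] whose phase makes the component of
    [T (z + s *: v)] along [z] grow to first order in [s], whereas the norm of
    [z + s *: v] grows only to second order; contractivity then forces the
    first-order term to vanish. *)
Lemma contraction_orth_eigenvector v : inner v z = 0 -> inner (T v) z = 0.
Proof.
move=> vz; apply/eqP/negPn/negP => a0.
set a := inner (T v) z in a0.
have V1 : 0 < `|v| ^+ 2 + 1 by rewrite ltr_wpDl ?exprn_ge0.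
pose t := (`|v| ^+ 2 + 1)^-1.
have t0 : 0 < t by rewrite invr_gt0.
(* The factor [mu * sconj a] makes [s * a] a positive multiple of [mu], and [t]
   is small enough for [t * `|v| ^+ 2 <= 1]. *)
pose s := t * mu * sconj a.
have tA0 : 0 < t * `|a| ^+ 2 by rewrite mulr_gt0// exprn_gt0// normr_gt0.
have norm_s : `|s| ^+ 2 = t ^+ 2 * `|a| ^+ 2.
  by rewrite !normrM mu1 mulr1 norm_sconj exprMn (ger0_norm (ltW t0)).
have zsv : `|z + s *: v| ^+ 2 <= `|z| ^+ 2 + t * `|a| ^+ 2.
  rewrite pythagoras; last by rewrite innerZr innerC vz sconj0 mulr0.
  rewrite normrZ exprMn norm_s lerD2l.
  have -> : t ^+ 2 * `|a| ^+ 2 * `|v| ^+ 2 = t * `|a| ^+ 2 * (t * `|v| ^+ 2).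
    ring.
  by rewrite ler_piMr ?(ltW tA0)// /t ler_pdivrMl// mulr1 lerDl.
have Tzsv : `|inner (T (z + s *: v)) z| = `|z| ^+ 2 + t * `|a| ^+ 2.
  rewrite linearD linearZ /= Tz innerDl !innerZl -/a -sqr_norm_inner.
  have -> : mu * `|z| ^+ 2 + s * a = mu * (`|z| ^+ 2 + t * `|a| ^+ 2).
    rewrite -sconj_mulC /s; ring.
  by rewrite normrM mu1 mul1r ger0_norm// addr_ge0 ?exprn_ge0// ltW.
have : (`|z| ^+ 2 + t * `|a| ^+ 2) ^+ 2 <=
       (`|z| ^+ 2 + t * `|a| ^+ 2) * `|z| ^+ 2.
  rewrite -[X in X ^+ 2 <= _]Tzsv.
  apply: le_trans (_ : (`|z + s *: v| * `|z|) ^+ 2 <= _).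
    rewrite lerXn2r ?nnegrE ?mulr_ge0//.
    by apply: le_trans (cauchy_schwarz _ _) _; rewrite ler_wpM2r.
  by rewrite exprMn ler_wpM2r ?exprn_ge0.
rewrite expr2 ler_pM2l; last by rewrite ltr_wpDl ?exprn_ge0.
by rewrite gerDl => /(lt_le_trans tA0); rewrite ltxx.
Qed.

Lemma contraction_adjoint_eigenvector x : inner (T x) z = mu * inner x z.
Proof.
have Z0 : `|z| ^+ 2 != 0 by rewrite expf_neq0// normr_eq0.
have := contraction_orth_eigenvector (scaled_rejection x z).
rewrite inner_scaled_rejection -sqr_norm_inner mulrC subrr => /(_ erefl).
rewrite linearB linearZ [T (_ *: z)]linearZ /= Tz innerBl !innerZl -sqr_norm_inner => /eqP.
rewrite subr_eq0 => /eqP e; apply: (mulfI Z0); rewrite e; ring.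
Qed.

Lemma rabs_inner_iter n x : rabs (inner (iter n T x) z) = rabs (inner x z).
Proof.
elim: n => //= n <-; rewrite contraction_adjoint_eigenvector rabsM.
have -> : rabs mu = 1.
  by apply: (@real_scalar_inj R F); rewrite real_scalar_rabs mu1 real_scalar1.
by rewrite mul1r.
Qed.

Lemma rnorm_iter_le n x : rnorm (iter n T x) <= rnorm x.
Proof.
elim: n => //= n; apply: le_trans.
by rewrite -(@le_real_scalar R F) !real_scalar_rnorm.
Qed.

(** Along the orbit of [x] the modulus of the component on [z] is constant, so
    the scalars that approximate [z + s *: v] have a modulus whose limit does
    not depend on [s]. The approximants eventually stay in a ball whose radius
    does not depend on [s], which leaves no room for [s *: v] with [s] large. *)
Lemma supercyclic_orth_eigenvector v :
  wl_seq_supercyclic T -> inner v z = 0 -> v = 0.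
Proof.
move=> [x [_ xT]] vz; apply/eqP/negPn/negP => v0.
have := rnorm_gt0 _ v0; have := rnorm_gt0 _ z0.
set c := rabs (inner x z) => nz nv.
have target (s : K) : 0 < c /\
    c * (rabs s * rnorm v ^+ 2) <= rnorm z ^+ 2 * (rnorm x * rnorm v).
  have [alpha [n_ [_ _ cvgu]]] := xT (z + s *: v).
  have cvgz : rabs (alpha k) * c @[k --> \oo] --> rnorm z ^+ 2.
    have := cvg_rabs _ _ (weak_cvg_inner _ _ z cvgu).
    rewrite innerDl innerZl vz mulr0 addr0 rabs_inner_diag.
    by under eq_fun do rewrite innerZl rabsM rabs_inner_iter.
  have cvgv : rabs (alpha k * inner (iter (n_ k) T x) v)
      @[k --> \oo] --> rabs s * rnorm v ^+ 2.
    have := cvg_rabs _ _ (weak_cvg_inner _ _ v cvgu).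
    rewrite innerDl innerZl (innerC z) vz sconj0 add0r rabsM rabs_inner_diag.
    by under eq_fun do rewrite innerZl.
  split.
    rewrite lt_neqAle rabs_ge0 andbT; apply/negP => /eqP c0.
    have : rnorm z ^+ 2 <= 0.
      by apply: (cvgr_to_le cvgz); apply: nearW => k; rewrite -c0 mulr0.
    by rewrite leNgt exprn_gt0.
  apply: (@ler_cvg_to _ \oo _ _
    (fun k => c * rabs (alpha k * inner (iter (n_ k) T x) v))
    (fun k => rabs (alpha k) * c * (rnorm x * rnorm v))).
  - by apply: cvgM => //; exact: cvg_cst.
  - by apply: cvgM => //; exact: cvg_cst.
  - apply: nearW => k; rewrite rabsM mulrA [c * _]mulrC ler_wpM2l//.
      by rewrite mulr_ge0 ?rabs_ge0.
    apply: le_trans (inner_rabs_le _ _) _.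
    by rewrite ler_wpM2r ?rnorm_ge0// rnorm_iter_le.
have [c0 _] := target 0.
set B := rnorm z ^+ 2 * (rnorm x * rnorm v) in target.
have B0 : 0 <= B by rewrite !mulr_ge0 ?exprn_ge0 ?rnorm_ge0.
(* At [s = r] the bound below reads [B + 1 <= B]. *)
pose r := (B + 1) / (c * rnorm v ^+ 2).
have r0 : 0 <= r by rewrite divr_ge0 ?addr_ge0// mulr_ge0 ?exprn_ge0 ?ltW.
have rr : rabs (real_scalar r : K) = r.
  apply: (@real_scalar_inj R F); rewrite real_scalar_rabs ger0_norm//.
  by rewrite -real_scalar0 le_real_scalar.
have [_] := target (real_scalar r); rewrite rr mulrCA.
rewrite divfK; last by rewrite mulf_neq0 ?expf_neq0// gt_eqF.
by rewrite gerDl ler10.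
Qed.

End Contractions.

(** * Subsequences and the unitary part *)

(** If [r] stays below [B - e] at infinitely many indices, these form a
    subsequence of upper limit at most [B - e]. *)
Lemma cvg_of_no_subsequence_limn_sup_lt (R : realType) (r : nat -> R) (B : R) :
  (forall n, 0 <= r n <= B) ->
  ~ (exists2 n_ : nat -> nat, {homo n_ : i j / (i < j)%N} &
      limn_sup (fun k => r (n_ k)) < B) ->
  r n @[n --> \oo] --> B.
Proof.
move=> rB nosub; apply: contrapT => /cvgrPdist_lt /existsNP[e /not_implyP[e0 far]].
apply: nosub; pose A := [set n | r n <= B - e].
have Aoo : infinite_set A.
  move=> /finite_seqP[s As]; apply: far; exists (\max_(i <- s) i).+1 => // n /= sn.
  have /andP[_ rnB] := rB n; rewrite ger0_norm ?subr_ge0// ltrBlDr -ltrBlDl ltNge.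
  apply/negP => An; have : n \in s by suff : [set` s] n by []; rewrite -As.
  move=> ns; have := @leq_bigmax_seq _ s xpredT (fun i => i) n ns isT.
  by rewrite leqNgt sn.
have [|f [fincr _ Af]] := infinite_increasing_seq_wf _ Aoo 0%N.
  by move=> n; apply: sub_finite_set (finite_II n.+1) => m /=.
exists f.
  move=> i j ij; have := fincr j i.
  by rewrite leEnat ltnNge => ->; rewrite -ltnNge.
have bnd : bounded_fun (fun k => r (f k)).
  exists B; split; first exact: num_real.
  move=> b Bb k _ /=; have /andP[r0 r1] := rB (f k).
  by rewrite ger0_norm// (le_trans r1)// ltW.
rewrite limn_supE//.
apply: (@le_lt_trans _ _ (sups (fun k => r (f k)) 0%N)).
  apply: ge_inf; last by exists 0%N.
  exact/bounded_fun_has_lbound_sups.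
apply: (@le_lt_trans _ _ (B - e)); last by rewrite ltrBlDr ltrDl.
apply: ge_sup; first by exists (r (f 0%N)); exists 0%N.
by move=> _ [k _ <-]; exact: Af.
Qed.

Theorem corollary6p1 (R : realType) (F : scalar_kind) (X : hilbertType R F)
    (T : {linear X -> X}) (M : csubspace X) (U : {linear M -> M})
    (X_infinite : infinite_dimensional X)
    (T_bounded : continuous T)
    (T_contraction : opnorm T <= 1)
    (T_supercyclic : wl_seq_supercyclic T)
    (U_unitary_part : is_unitary_part T U) :
  weakly_stable T \/
  (forall y : M,
    wl_seq_supercyclic_vector U y ->
    ~ weak_cvg (fun n => iter n U y) 0 ->
    forall z : M, z != 0 ->
    ~ (inner (iter n U y) z @[n --> \oo] --> (0 : (base_field R F)^o)) ->
    limn_inf (fun n => rabs (inner (iter n U y) z)) = 0 \/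
    exists2 n_ : nat -> nat, {homo n_ : i j / (i < j)%N} &
      limn_sup (fun k => rabs (inner (iter (n_ k) U y) z)) < rnorm z * rnorm y).
Proof.
right=> y [y0 _] _ z z0 _; right; apply: contrapT => nosub.
have [_ TU [A [UA UK _]] _] := U_unitary_part.
have U_inner (x w : M) : inner (U x) (U w) = inner x w by rewrite UA UK.
have U_norm (x : M) : rnorm (U x) = rnorm x.
  apply: (@real_scalar_inj R F); rewrite !real_scalar_rnorm.
  by apply/eqP; rewrite -(@eqrXn2 _ 2)// !sqr_norm_inner U_inner.
have iter_norm n : rnorm (iter n U y) = rnorm y by elim: n => //= n <-.
have align : rabs (inner (iter n U y) z) @[n --> \oo] --> rnorm z * rnorm y.
  apply: cvg_of_no_subsequence_limn_sup_lt nosub => n.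
  by rewrite rabs_ge0/= -(iter_norm n) mulrC inner_rabs_le.
have Uz : `|z| ^+ 2 *: U z = inner (U z) z *: z.
  apply: (parallel_of_asymptotic_alignment (fun n => iter n.+1 U y) _ _ _
    (rnorm_gt0 _ y0) z0 (fun n => iter_norm n.+1)).
    have := align.
    by rewrite -(cvg_shiftS (fun n => rabs (inner (iter n U y) z))).
  rewrite U_norm.
  suff -> : (fun n => rabs (inner (iter n.+1 U y) (U z))) =
            (fun n => rabs (inner (iter n U y) z)) by [].
  by apply/funext => n; rewrite iterS; congr rabs; exact: U_inner.
have Z0 : `|z| ^+ 2 != 0 by rewrite expf_neq0// normr_eq0.
pose mu := inner (U z) z / `|z| ^+ 2.
have Uz_mu : U z = mu *: z.
  by rewrite /mu mulrC -scalerA -Uz scalerA mulVf ?scale1r.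
have mu1 : `|mu| = 1.
  have nz0 : `|z| != 0 by rewrite normr_eq0.
  apply: (mulIf nz0); rewrite mul1r -normrZ -Uz_mu.
  by rewrite -!real_scalar_rnorm U_norm.
pose zX : X := csubspace_val z.
have zX0 : zX != 0 by apply: contra_neq z0 => zX0; exact: val_inj.
have Tz : T zX = mu *: zX.
  by rewrite -TU Uz_mu linearZ.
have T_le := contraction_norm_le T T_bounded T_contraction.
apply: (X_infinite 1%N (fun=> zX)) => x.
have ZX0 : `|zX| ^+ 2 != 0 by rewrite expf_neq0// normr_eq0.
exists (fun=> inner x zX / `|zX| ^+ 2); rewrite big_ord1.
have rej0 : scaled_rejection x zX = 0.
  apply: (supercyclic_orth_eigenvector T T_le zX mu zX0 Tz mu1) => //.
  by rewrite inner_scaled_rejection -sqr_norm_inner mulrC subrr.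
move/eqP: rej0; rewrite subr_eq0 => /eqP e.
by rewrite mulrC -scalerA -e scalerA mulVf ?scale1r.
Qed.
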